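(* Let $P$ be a monoid and let $\Lambda$ be a nonempty $P$-graph such that $\Lambda^0$ has property $\mathsf{W}$ and $\Lambda^0_{\operatorname{Per}}=\Lambda^0$. Let $\mathbf{q}:\mathcal{G}(P)\to\mathcal{G}(P)/\operatorname{Per}\Lambda$ be the quotient map. Then the pushout $\Lambda/\!\sim$ is an aperiodic $\mathbf{q}(P)$-graph.
   Context: All monoids are finitely generated, cancellative and abelian; $P$ is embedded in its Grothendieck group $\mathcal{G}(P)$ and is also regarded as a category with one object. A $P$-graph is a countable small category $\Lambda$ (identified with its set of morphisms) with a functor $d:\Lambda\to P$ satisfying the factorization property: whenever $d(\xi)=p+q$ there are unique $\eta,\zeta\in\Lambda$ with $d(\eta)=p$, $d(\zeta)=q$, $\xi=\eta\zeta$. $\Lambda^p=d^{-1}(p)$, $\Lambda^0$ is the vertex set, $r,s:\Lambda\to\Lambda^0$ are the range and source maps, $v\Lambda=\{\xi:r(\xi)=v\}$, $v\Lambda^p=v\Lambda\cap\Lambda^p$, $u\Lambda w=\{\xi: r(\xi)=u,s(\xi)=w\}$. All $P$-graphs are assumed row-finite and source-free: $0<|v\Lambda^p|<\infty$ for all $v\in\Lambda^0$, $p\in P$. $\Lambda^0$ has property $\mathsf{W}$ if for any $u,v\in\Lambda^0$ there is $w\in\Lambda^0$ with $u\Lambda w\ne\varnothing$ and $v\Lambda w\neq\varnothing$. $\Omega_P=\{(p,q)\in P\times P: q-p\in P\}$ is the $P$-graph with $d(p,q)=q-p$, $s(p,q)=q$, $r(p,q)=p$. An infinite path of $\Lambda$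 is a degree-preserving functor $x:\Omega_P\to\Lambda$; $\Lambda^\infty$ is the set of these, and $v\Lambda^\infty$ the set of those with range $x(0,0)=v$. For $p\in P$, $\sigma^p(x)(q,r)=x(p+q,p+r)$. For $\mu\in\Lambda$ and $x\in s(\mu)\Lambda^\infty$, $\mu x$ is the unique infinite path with $(\mu x)(0,p)=\mu\cdot x(0,p-d(\mu))$ for all $p\in P$ with $p-d(\mu)\in P$. An infinite path $x$ is periodic if $\sigma^p(x)=\sigma^q(x)$ for some $p\ne q$ in $P$. A $P$-graph $\Lambda$ is periodic if there is $v\in\Lambda^0$ such that every $x\in v\Lambda^\infty$ is periodic; otherwise it is aperiodic. The equivalence relation $\sim$ on $\Lambda$: $\xi\sim\eta$ iff $s(\xi)=s(\eta)$ and $\xi x=\eta x$ for all $x\in s(\xi)\Lambda^\infty$ (then also $r(\xi)=r(\eta)$). $\operatorname{Per}\Lambda=\{d(\xi)-d(\eta):\xi,\eta\in\Lambda,\ \xi\sim\eta\}\subseteq\mathcal{G}(P)$; it is a subgroup when $\Lambda^0$ has property $\mathsf{W}$. $\Lambda^0_{\operatorname{Per}}$ is the set of $v\in\Lambda^0$ such that for any $\xi\in v\Lambda$ and $p\in P$ with $d(\xi)-p\in\operatorname{Per}\Lambda$ there is $\eta\in v\Lambda^p$ with $\xi\sim\eta$. When $\Lambda^0_{\operatorname{Per}}=\Lambda^0$, the pushout of $\Lambda$ is the quotient category $\Lambda/\!\sim$, with $r([\xi])=[r(\xi)]$, $s([\xi])=[s(\xi)]$, $[\xi][\eta]=[\xi\eta]$,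 and degree map $\tilde d([\xi])=\mathbf{q}(d(\xi))$. *)

(* Defs.v *)
From HB Require Import structures.
From mathcomp Require Import all_boot all_order all_algebra.
From mathcomp Require Import boolp classical_sets functions cardinality.
Set Implicit Arguments.
Unset Strict Implicit.
Unset Printing Implicit Defensive.
Import GRing.Theory.
Local Open Scope classical_set_scope.
Local Open Scope quotient_scope.
Local Open Scope ring_scope.

Definition cancellative (P : nmodType) : Prop :=
  forall p q t : P, p + t = q + t -> p = q.

Definition finitely_generated (P : nmodType) : Prop :=
  exists gen : seq P, forall p : P,
    exists c : 'I_(size gen) -> nat, p = \sum_(i < size gen) gen`_i *+ c i.

(** * Grothendieck group *)

Section Grothendieck.
Variable P : nmodType.
Implicit Types a b c : P * P.

(* A pair (p, q) stands for the formal difference p - q. *)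
Definition groth_rel a b : bool :=
  `[< exists t, a.1 + b.2 + t = b.1 + a.2 + t >].

Lemma groth_rel_refl : reflexive groth_rel.
Proof. by move=> a; apply/asboolP; exists 0. Qed.

Lemma groth_rel_sym : symmetric groth_rel.
Proof. by move=> a b; apply/asboolP/asboolP => -[t e]; exists t; rewrite e. Qed.

Lemma groth_rel_trans : transitive groth_rel.
Proof.
move=> b a c /asboolP[t e] /asboolP[u f]; apply/asboolP.
exists (b.2 + t + (b.1 + u)).
rewrite [LHS](AC (2*(2*2)) (1*3*4*(5*2*6)))/= e f.
by rewrite [LHS](AC (3*3) (4*2*(5*3*(1*6)))).

Qed.

Canonical groth_equiv :=
  EquivRel groth_rel groth_rel_refl groth_rel_sym groth_rel_trans.

Definition groth := {eq_quot groth_rel}.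

HB.instance Definition _ := Choice.on groth.
HB.instance Definition _ := EqQuotient.on groth.

Definition groth0 : groth := \pi_groth (0, 0).
Definition groth_opp (x : groth) : groth := \pi_groth ((repr x).2, (repr x).1).
Definition groth_add (x y : groth) : groth :=
  \pi_groth ((repr x).1 + (repr y).1, (repr x).2 + (repr y).2).

Lemma groth_piP a b :
  reflect (exists t, a.1 + b.2 + t = b.1 + a.2 + t) (a == b %[mod groth]).
Proof. by rewrite piE; apply: asboolP. Qed.

Lemma groth_reprP a : exists t,
  (repr (\pi_groth a)).1 + a.2 + t = a.1 + (repr (\pi_groth a)).2 + t.
Proof. by apply/groth_piP; rewrite reprK. Qed.

Lemma groth_add_pi a b :
  groth_add (\pi_groth a) (\pi_groth b) = \pi_groth (a.1 + b.1, a.2 + b.2).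
Proof.
have [t e] := groth_reprP a; have [u f] := groth_reprP b.
apply/eqP/groth_piP; exists (t + u) => /=.
rewrite [LHS](AC (2*2*2) (1*3*5*(2*4*6)))/= e f.
by rewrite [LHS](AC (3*3) (1*4*(2*5)*(3*6))).
Qed.

Lemma groth_opp_pi a : groth_opp (\pi_groth a) = \pi_groth (a.2, a.1).
Proof.
have [t e] := groth_reprP a.
apply/eqP/groth_piP; exists t => /=.
by rewrite [_ + a.1]addrC -e [a.2 + _]addrC.
Qed.

Lemma groth_addA : associative groth_add.
Proof.
move=> x y z; rewrite -[x]reprK -[y]reprK -[z]reprK.
move: (repr x) (repr y) (repr z) => a b c.
by rewrite (groth_add_pi b c) (groth_add_pi a b) 2!groth_add_pi /= !addrA.
Qed.

Lemma groth_addC : commutative groth_add.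
Proof.
move=> x y; rewrite -[x]reprK -[y]reprK.
move: (repr x) (repr y) => a b; rewrite (groth_add_pi a b) (groth_add_pi b a).
by rewrite addrC [a.2 + _]addrC.
Qed.

Lemma groth_add0 : left_id groth0 groth_add.
Proof.
move=> x; rewrite -[x]reprK; move: (repr x) => a.
by rewrite groth_add_pi /= !add0r -surjective_pairing.
Qed.

Lemma groth_addN : left_inverse groth0 groth_opp groth_add.
Proof.
move=> x; rewrite -[x]reprK; move: (repr x) => a.
rewrite groth_opp_pi groth_add_pi.
by apply/eqP/groth_piP; exists 0; rewrite /= !addr0 add0r addrC.
Qed.

HB.instance Definition _ :=
  GRing.isZmodule.Build groth groth_addA groth_addC groth_add0 groth_addN.

(* For cancellative P this is the embedding of P in its Grothendieck group. *)
Definition groth_in (p : P) : groth := \pi_groth (p, 0).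

Lemma groth_in_nmod_morphism : nmod_morphism groth_in.
Proof.
split=> [//|p q]; rewrite /groth_in.
by have := groth_add_pi (p, 0) (q, 0); rewrite /= addr0 => <-.
Qed.

HB.instance Definition _ :=
  GRing.isNmodMorphism.Build P groth groth_in groth_in_nmod_morphism.

Definition groth_monoid : {pred groth} :=
  fun g => `[< exists p, groth_in p = g >].

Lemma groth_monoid_closed : GRing.addumagma_closed groth_monoid.
Proof.
split=> [|x y /asboolP[p <-] /asboolP[q <-]]; apply/asboolP.
  by exists 0; rewrite raddf0.
by exists (p + q); rewrite raddfD.
Qed.

HB.instance Definition _ :=
  GRing.isAddClosed.Build groth groth_monoid groth_monoid_closed.

End Grothendieck.

Arguments groth_monoid P : clear implicits.

(** * Quotients of abelian groups *)

Section SubgroupGenerated.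
Variables (G : zmodType) (S : set G).

Definition subgroup_generated : {pred G} :=
  fun g => `[< forall N : zmodClosed G, (forall h, S h -> h \in N) -> g \in N >].

Lemma subgroup_generated_closed : zmod_closed subgroup_generated.
Proof.
split=> [|x y /asboolP Nx /asboolP Ny]; apply/asboolP => N SN.
  exact: rpred0.
by rewrite rpredB ?Nx ?Ny.
Qed.

HB.instance Definition _ :=
  GRing.isZmodClosed.Build G subgroup_generated subgroup_generated_closed.

End SubgroupGenerated.

Section ImageMonoid.
Variables (U V : zmodType) (f : {additive U -> V}) (S : addrClosed U).

Definition image_monoid : {pred V} :=
  fun y => `[< exists2 x, x \in S & f x = y >].

Lemma image_monoid_closed : GRing.addumagma_closed image_monoid.
Proof.
split=> [|x y /asboolP[a Sa <-] /asboolP[b Sb <-]]; apply/asboolP.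
  by exists 0; rewrite ?rpred0 ?raddf0.
by exists (a + b); rewrite ?rpredD ?raddfD.
Qed.

HB.instance Definition _ :=
  GRing.isAddClosed.Build V image_monoid image_monoid_closed.

End ImageMonoid.

(** * P-graphs *)

(* Raw data of a small category, identified with its set of morphisms (a vertex
   is an identity morphism), together with a degree map.  [comp a b c] means
   that the product ab is defined and equal to c. *)
Record pregraph (G : zmodType) := Pregraph {
  mor :> choiceType;
  rng : mor -> mor;
  src : mor -> mor;
  comp : mor -> mor -> mor -> Prop;
  deg : mor -> G
}.

Section Category.
Variables (G : zmodType) (L : pregraph G).

Record is_category : Prop := IsCategory {
  rng_rng : forall a : L, rng (rng a) = rng a;
  src_rng : forall a : L, src (rng a) = rng a;
  rng_src : forall a : L, rng (src a) = src a;
  src_src : forall a : L, src (src a) = src a;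
  comp_defined : forall a b : L, (exists c, comp a b c) <-> src a = rng b;
  comp_unique : forall a b c c' : L, comp a b c -> comp a b c' -> c = c';
  rng_comp : forall a b c : L, comp a b c -> rng c = rng a;
  src_comp : forall a b c : L, comp a b c -> src c = src b;
  comp_rng : forall a : L, comp (rng a) a a;
  comp_src : forall a : L, comp a (src a) a;
  comp_assoc : forall a b c ab bc x : L,
    comp a b ab -> comp b c bc -> comp ab c x -> comp a bc x
}.

Definition vertices : set L := [set v | rng v = v].
Definition paths_to (v : L) (p : G) : set L :=
  [set a | rng a = v /\ deg a = p].

Definition propertyW : Prop :=
  forall u v, vertices u -> vertices v -> exists w, vertices w /\
    (exists a : L, rng a = u /\ src a = w) /\
    (exists b : L, rng b = v /\ src b = w).

End Category.

Arguments vertices {G} L.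

(* Row-finiteness and absence of sources are part of the definition. *)
Record is_Pgraph (G : zmodType) (P : addrClosed G) (L : pregraph G) : Prop :=
  IsPgraph {
  Pgraph_category : is_category L;
  Pgraph_countable : countable [set: L];
  deg_in : forall a : L, deg a \in P;
  deg_vertex : forall v : L, vertices L v -> deg v = 0;
  deg_comp : forall a b c : L, comp a b c -> deg c = deg a + deg b;
  factorization : forall (p q : G) (c : L), p \in P -> q \in P ->
    deg c = p + q ->
    exists! ab : L * L, [/\ deg ab.1 = p, deg ab.2 = q & comp ab.1 ab.2 c];
  row_finite : forall (v : L) (p : G), vertices L v -> p \in P ->
    finite_set (paths_to v p);
  source_free : forall (v : L) (p : G), vertices L v -> p \in P ->
    paths_to v p !=set0
}.

(** * The P-graph Omega_P *)

Section Omega.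
Variables (G : zmodType) (P : addrClosed G).

Definition in_Omega (w : G * G) : bool :=
  [&& w.1 \in P, w.2 \in P & w.2 - w.1 \in P].

Definition Omega := {w : G * G | in_Omega w}.

HB.instance Definition _ := Choice.on Omega.

Lemma in_Omega_diag p : p \in P -> in_Omega (p, p).
Proof. by move=> Pp; rewrite /in_Omega /= Pp subrr rpred0. Qed.

Definition Omega_rng (w : Omega) : Omega :=
  Sub ((val w).1, (val w).1)
    (in_Omega_diag (let: And3 h _ _ := and3P (valP w) in h)).
Definition Omega_src (w : Omega) : Omega :=
  Sub ((val w).2, (val w).2)
    (in_Omega_diag (let: And3 _ h _ := and3P (valP w) in h)).

Definition Omega_graph : pregraph G :=
  @Pregraph G Omega Omega_rng Omega_src
    (fun a b c => (val a).2 = (val b).1 /\ val c = ((val a).1, (val b).2))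
    (fun w => (val w).2 - (val w).1).

Definition Omega0 : Omega := Sub (0, 0) (in_Omega_diag (rpred0 P)).

(* The pair (p, q); it is only used where (p, q) does belong to Omega_P, and
   has the junk value (0, 0) otherwise. *)
Definition opair (p q : G) : Omega_graph := insubd Omega0 (p, q).

End Omega.

(** * Infinite paths *)

Definition is_degree_functor (G : zmodType) (A B : pregraph G) (f : A -> B) :
    Prop :=
  [/\ forall a, f (rng a) = rng (f a),
      forall a, f (src a) = src (f a),
      forall a b c, comp a b c -> comp (f a) (f b) (f c)
    & forall a, deg (f a) = deg a].

Section InfinitePaths.
Variables (G : zmodType) (P : addrClosed G) (L : pregraph G).
Implicit Types (x y : Omega_graph P -> L) (a b mu : L).

Definition infinite_paths : set (Omega_graph P -> L) :=
  [set x | is_degree_functor x].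

Definition infinite_paths_to (v : L) : set (Omega_graph P -> L) :=
  infinite_paths `&` [set x | x (opair P 0 0) = v].

Definition shift (p : G) x : Omega_graph P -> L :=
  fun w => x (opair P (p + (val w).1) (p + (val w).2)).

Definition is_prepend mu x y : Prop :=
  infinite_paths y /\
  forall p, p \in P -> p - deg mu \in P ->
    comp mu (x (opair P 0 (p - deg mu))) (y (opair P 0 p)).

(* In a P-graph, [is_prepend mu x] holds of exactly one y as soon as x is an
   infinite path with range the source of mu. *)
Definition prepend mu x : Omega_graph P -> L := xget x (is_prepend mu x).

Definition periodic_path x : Prop :=
  exists p q, [/\ p \in P, q \in P, p != q & shift p x = shift q x].

Definition periodic : Prop :=
  exists2 v : L, vertices L v & forall x, infinite_paths_to v x -> periodic_path x.

Definition aperiodic : Prop := ~ periodic.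

Definition path_eq a b : Prop :=
  src a = src b /\
  forall x, infinite_paths_to (src a) x -> prepend a x = prepend b x.

Definition Per : set G :=
  [set g | exists a b, path_eq a b /\ g = deg a - deg b].

Definition Per_vertices : set L :=
  [set v | vertices L v /\
    forall (a : L) (p : G), rng a = v -> p \in P -> Per (deg a - p) ->
      exists2 b, paths_to v p b & path_eq a b].

(** * Pushout *)

Definition path_eqb a b : bool := `[< path_eq a b >].

Lemma path_eqb_refl : reflexive path_eqb.
Proof. by move=> a; apply/asboolP. Qed.

Lemma path_eqb_sym : symmetric path_eqb.
Proof.
by move=> a b; apply/asboolP/asboolP => -[e h]; split=> // x;
  rewrite -e => /h ->.
Qed.

Lemma path_eqb_trans : transitive path_eqb.
Proof.
move=> b a c /asboolP[e h] /asboolP[f k]; apply/asboolP; split=> [|x hx].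
  by rewrite e.
by rewrite h// k// -e.
Qed.

Canonical path_equiv :=
  EquivRel path_eqb path_eqb_refl path_eqb_sym path_eqb_trans.

(* [Per] is a subgroup whenever the vertices have property W, and then it is
   the subgroup it generates. *)
Local Notation G_Per := (Quotient.quot (subgroup_generated Per)).

Definition quotient_map : G -> G_Per := \pi_G_Per.

HB.instance Definition _ := GRing.Additive.copy quotient_map \pi_G_Per.

Definition pushout_mor := {eq_quot path_eqb}.

(* Range, source and degree are computed on a representative; in a P-graph they
   do not depend on it, since equivalent paths have the same range and source
   and their degrees differ by an element of [Per]. *)
Definition pushout : pregraph G_Per :=
  @Pregraph G_Per pushout_mor
    (fun c => \pi_pushout_mor (rng (repr c)))
    (fun c => \pi_pushout_mor (src (repr c)))
    (fun c1 c2 c3 => exists a b ab, comp a b ab /\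
      [/\ c1 = \pi_pushout_mor a, c2 = \pi_pushout_mor b
        & c3 = \pi_pushout_mor ab])
    (fun c => quotient_map (deg (repr c))).

End InfinitePaths.

Arguments Per_vertices {G} P L.
Arguments quotient_map {G} P L.

(* Main.v *)
(** Whether two paths a, b are equivalent can be tested on finite paths: a ~
    b if and only if, for every finite z, the paths az and bz have the same
    initial segment in every degree for which both have one. Equivalent
    paths of equal degree coincide, so the quotient map preserves initial
    segments, and classes equivalent in the pushout come from equivalent
    paths of the graph; hence they have equal degrees there. If p <> q and c
    is a finite path of the pushout, some extension of c therefore forces
    the shifts by p and q to differ on all infinite paths through it. The
    pairs (p, q) are countably many, so iterating this yields an infinite
    path without any period. *)

Require Import Defs.
From HB Require Import structures.
From mathcomp Require Import all_boot all_order all_algebra.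
From mathcomp Require Import boolp classical_sets functions cardinality.
Set Implicit Arguments.
Unset Strict Implicit.
Unset Printing Implicit Defensive.
(* Reimported so that [comp] is not the composition of functions. *)
Require Import Defs.
Import GRing.Theory.
Local Open Scope classical_set_scope.
Local Open Scope quotient_scope.
Local Open Scope ring_scope.

(** * Initial segments of finite paths *)

Section PrefixOrder.
Variables (G : zmodType) (L : pregraph G).
Implicit Types a b c z : L.

Definition is_prefix a c : Prop := exists b, comp a b c.

(** [P] need not be lattice ordered, so there may be no largest common degree; all common degrees
    are compared. *)
Definition agree c c' : Prop :=
  forall a a', is_prefix a c -> is_prefix a' c' -> deg a = deg a' -> a = a'.

(* A finitary form of [path_eq]: equality of the infinite paths [a x] and [b x]
   is tested on finite initial segments only. *)
Definition finite_path_eq a b : Prop :=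
  src a = src b /\
  forall z c c', comp a z c -> comp b z c' -> agree c c'.

End PrefixOrder.

(** * Paths of a P-graph *)

Section Pgraph.
Variables (G : zmodType) (P : addrClosed G) (L : pregraph G).
Hypothesis gL : is_Pgraph P L.
Implicit Types (a b c u v z : L) (p q : G).

Let cL : is_category L := Pgraph_category gL.

Lemma comp_ex a b : src a = rng b -> exists c, comp a b c.
Proof. by move/(comp_defined cL). Qed.

Lemma comp_src_rng a b c : comp a b c -> src a = rng b.
Proof. by move=> abc; apply/(comp_defined cL); exists c. Qed.

Lemma deg_rng a : deg (rng a) = 0.
Proof. exact: (deg_vertex gL (rng_rng cL a)). Qed.

Lemma vertices_rng a : vertices L (rng a).
Proof. exact: (rng_rng cL a). Qed.

Lemma vertices_src a : vertices L (src a).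
Proof. exact: (rng_src cL a). Qed.

Lemma deg_src a : deg (src a) = 0.
Proof. exact: (deg_vertex gL (vertices_src a)). Qed.

Lemma comp_assocr a b c bc x :
  comp b c bc -> comp a bc x -> exists2 ab, comp a b ab & comp ab c x.
Proof.
move=> hbc habc.
have [ab hab] : exists ab, comp a b ab.
  by apply: comp_ex; rewrite (comp_src_rng habc) (rng_comp cL hbc).
have [y hy] : exists y, comp ab c y.
  by apply: comp_ex; rewrite (src_comp cL hab) (comp_src_rng hbc).
exists ab => //.
by rewrite (comp_unique cL habc (comp_assoc cL hab hbc hy)).
Qed.

Lemma comp_inj a b a' b' c :
  comp a b c -> comp a' b' c -> deg a = deg a' -> a = a' /\ b = b'.
Proof.
move=> h h' da.
have db : deg b = deg b'.
  apply: (addrI (deg a)).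
  by rewrite -(deg_comp gL h) (deg_comp gL h') da.
have [ab [_ U]] := factorization gL (deg_in gL a) (deg_in gL b) (deg_comp gL h).
have e := U (a, b) (And3 erefl erefl h).
have e' := U (a', b') (And3 (esym da) (esym db) h').
by move: e'; rewrite e => -[-> ->].
Qed.

(** [a] factors both as [a (src a)] and as [(rng a) a], and both first factors have degree 0. *)
Lemma deg0_src a : deg a = 0 -> src a = a.
Proof.
move=> da; have := comp_inj (comp_src cL a) (comp_rng cL a).
by rewrite da deg_rng => /(_ erefl)[_].
Qed.

Lemma deg0_vertex a : deg a = 0 -> vertices L a.
Proof. by move/deg0_src => <-; apply: vertices_src. Qed.

Lemma prefix_refl a : is_prefix a a.
Proof. by exists (src a); apply: comp_src. Qed.

Lemma prefix_trans b a c : is_prefix a b -> is_prefix b c -> is_prefix a c.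
Proof.
move=> [x ab] [y bc].
have [z hz] : exists z, comp x y z.
  by apply: comp_ex; rewrite -(src_comp cL ab) (comp_src_rng bc).
by exists z; apply: (comp_assoc cL) hz bc.
Qed.

Lemma prefix_inj a a' c :
  is_prefix a c -> is_prefix a' c -> deg a = deg a' -> a = a'.
Proof. by move=> [b h] [b' h'] /(comp_inj h h')[]. Qed.

Lemma prefix_comp a b c x y :
  comp a b x -> comp a c y -> is_prefix b c -> is_prefix x y.
Proof.
move=> hx hy [d bd].
have [ab hab h] := comp_assocr bd hy.
by exists d; rewrite (comp_unique cL hx hab).
Qed.

Lemma factor c p : p \in P -> deg c - p \in P ->
  exists a b, [/\ deg a = p, deg b = deg c - p & comp a b c].
Proof.
move=> Pp Pc.
have dc : deg c = p + (deg c - p) by rewrite addrC subrK.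
by have [[a b] [[/= da db abc] _]] := factorization gL Pp Pc dc; exists a, b.
Qed.

Lemma extend a p : p \in P -> exists b c, deg b = p /\ comp a b c.
Proof.
move=> Pp; have [b [rb db]] := source_free gL (vertices_src a) Pp.
by have [c abc] := comp_ex (esym rb); exists b, c.
Qed.

Lemma finite_path_eq_deg a b : finite_path_eq a b -> deg a = deg b -> a = b.
Proof.
move=> [sab h]; apply: h (prefix_refl a) (prefix_refl b).
- exact: comp_src.
- by rewrite sab; exact: comp_src.
Qed.

Lemma finite_path_eq_rng a b : finite_path_eq a b -> rng a = rng b.
Proof.
move=> [sab h].
have ha := comp_src cL a; have hb := comp_src cL b; rewrite -sab in hb.
apply: (h _ _ _ ha hb); rewrite ?deg_rng //.
- by exists a; apply: comp_rng.
- by exists b; apply: comp_rng.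
Qed.

(** Testing [ab] against [z] is testing [a] against [b z]. *)
Lemma finite_path_eq_compl a a' b ab a'b :
  finite_path_eq a a' -> comp a b ab -> comp a' b a'b -> finite_path_eq ab a'b.
Proof.
move=> [_ h] cab ca'b; split=> [|z c c' hc hc'].
  by rewrite (src_comp cL cab) (src_comp cL ca'b).
have [bz hbz] : exists bz, comp b z bz.
  by apply: comp_ex; rewrite -(src_comp cL cab) (comp_src_rng hc).
exact: h (comp_assoc cL cab hbz hc) (comp_assoc cL ca'b hbz hc').
Qed.

(** The initial segment of degree [p] of [a y] is determined by [a] and the initial segment [t] of
    degree [p] of [y], since it also begins [a t]. *)
Lemma finite_path_eq_compr a b b' ab ab' :
  finite_path_eq b b' -> comp a b ab -> comp a b' ab' -> finite_path_eq ab ab'.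
Proof.
move=> [sb h] cab cab'; split=> [|z c c' hc hc'].
  by rewrite (src_comp cL cab) (src_comp cL cab').
move=> u u' uc uc' du.
(* [z] is extended by a path [w] of degree [deg u], so that the initial
   segments of degree [deg u] of [b z w] and [b' z w] exist. *)
have Pu := deg_in gL u.
have [w [zw [dw hzw]]] := extend z Pu.
have [bzw hbzw] : exists x, comp b zw x.
  apply: comp_ex; rewrite -(src_comp cL cab) (rng_comp cL hzw).
  exact: comp_src_rng hc.
have [b'zw hb'zw] : exists x, comp b' zw x.
  by apply: comp_ex; rewrite -sb (comp_src_rng hbzw).
have seg x y : comp x zw y ->
    exists t, deg t = deg u /\ is_prefix t y.
  move=> hy; have [] := @factor y (deg u) Pu.
    rewrite (deg_comp gL hy) (deg_comp gL hzw) dw addrA addrK.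
    by rewrite rpredD ?(deg_in gL).
  by move=> t [t' [dt _ ht]]; exists t; split=> //; exists t'.
have [t [dt tb]] := seg _ _ hbzw; have [t' [dt' tb']] := seg _ _ hb'zw.
have ett' : t = t' by apply: (h _ _ _ hbzw hb'zw) => //; rewrite dt.
subst t'.
have [at_ hat] : exists x, comp a t x.
  apply: comp_ex; rewrite (comp_src_rng cab).
  case: tb => s hs; rewrite -(rng_comp cL hs).
  by rewrite (rng_comp cL hbzw).
have [v [v' [dv _ hv]]] : exists v v',
    [/\ deg v = deg u, deg v' = deg at_ - deg u & comp v v' at_].
  by apply: factor => //; rewrite (deg_comp gL hat) dt addrK (deg_in gL).
have main b0 ab0 c0 u0 b0zw : comp a b0 ab0 -> comp ab0 z c0 ->
    is_prefix u0 c0 -> deg u0 = deg u -> comp b0 zw b0zw ->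
    is_prefix t b0zw -> u0 = v.
  move=> h1 h2 pu0 du0 h3 pt.
  have [c1 hc1] : exists x, comp ab0 zw x.
    by apply: comp_ex; rewrite (src_comp cL h1) (comp_src_rng h3).
  apply: (@prefix_inj _ _ c1); last by rewrite du0 dv.
    apply: prefix_trans pu0 _; apply: prefix_comp h2 hc1 _.
    by exists w.
  apply: (@prefix_trans at_); first by exists v'.
  by apply: prefix_comp hat _ pt; apply: comp_assoc h1 h3 hc1.
rewrite (main _ _ _ _ _ cab hc uc erefl hbzw tb).
by rewrite (main _ _ _ _ _ cab' hc' uc' (esym du) hb'zw tb').
Qed.

(** * Infinite paths and their initial segments *)

Lemma val_opair p q : p \in P -> q \in P -> q - p \in P ->
  val (opair P p q : Omega P) = (p, q).
Proof.
by move=> Pp Pq Ppq; rewrite /opair val_insubd /in_Omega /= Pp Pq Ppq.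
Qed.

Lemma opair_val (w : Omega_graph P) : w = opair P (val w).1 (val w).2.
Proof.
have /and3P[h1 h2 h3] := valP w.
by apply: val_inj; rewrite val_opair // -surjective_pairing.
Qed.

Lemma path_comp (x : Omega_graph P -> L) p q r : infinite_paths x ->
  p \in P -> q - p \in P -> r - q \in P ->
  comp (x (opair P p q)) (x (opair P q r)) (x (opair P p r)).
Proof.
move=> [_ _ hc _] Pp Pqp Prq.
have Pq : q \in P by rewrite -(subrK p q) rpredD.
have Pr : r \in P by rewrite -(subrK q r) rpredD.
have Prp : r - p \in P by rewrite -(subrK q r) -addrA rpredD.
by apply: hc; rewrite /= !val_opair.
Qed.

Lemma path_deg (x : Omega_graph P -> L) p q : infinite_paths x ->
  p \in P -> q - p \in P -> deg (x (opair P p q)) = q - p.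
Proof.
move=> [_ _ _ hd] Pp Pqp.
have Pq : q \in P by rewrite -(subrK p q) rpredD.
by rewrite hd /= val_opair.
Qed.

Lemma path_deg0 (x : Omega_graph P -> L) p : infinite_paths x ->
  p \in P -> deg (x (opair P 0 p)) = p.
Proof. by move=> hx Pp; rewrite path_deg ?rpred0 ?subr0. Qed.

Lemma path_prefix (x : Omega_graph P -> L) p q : infinite_paths x ->
  p \in P -> q - p \in P ->
  is_prefix (x (opair P 0 p)) (x (opair P 0 q)).
Proof.
move=> hx Pp Pqp; exists (x (opair P p q)).
by apply: path_comp; rewrite ?rpred0 ?subr0.
Qed.

Lemma path_rng (x : Omega_graph P -> L) p : infinite_paths x -> p \in P ->
  rng (x (opair P 0 p)) = x (opair P 0 0).
Proof.
move=> hx Pp.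
have h := @path_comp x 0 0 p hx; rewrite subrr subr0 rpred0 in h.
have {}h := h erefl erefl Pp.
rewrite (rng_comp cL h).
have v0 : deg (x (opair P 0 0)) = 0 by rewrite path_deg0 ?rpred0.
exact: deg0_vertex v0.
Qed.

(** The value at [(p, q)] is what remains of the value at [(0, q)] after the one at [(0, p)]. *)
Lemma path_ext (x y : Omega_graph P -> L) :
  infinite_paths x -> infinite_paths y ->
  (forall p, p \in P -> x (opair P 0 p) = y (opair P 0 p)) -> x = y.
Proof.
move=> hx hy e; apply: funext => w; rewrite (opair_val w).
have /and3P[] := valP w; move: (val w).1 (val w).2 => p q Pp Pq Pqp.
have := @path_comp x 0 p q hx; have := @path_comp y 0 p q hy.
rewrite rpred0 !subr0 -!e // => /(_ erefl Pp Pqp) hy' /(_ erefl Pp Pqp) hx'.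
by have [] := comp_inj hx' hy' erefl.
Qed.

(** * Infinite paths as limits of increasing sequences of finite paths *)

Section PathOfPrefixes.
Variable xi : nat -> L.
Hypothesis xi_prefix : forall n, is_prefix (xi n) (xi n.+1).
Hypothesis xi_cofinal : forall p, p \in P -> exists n, deg (xi n) - p \in P.

Lemma xi_le m n : (m <= n)%N -> is_prefix (xi m) (xi n).
Proof.
move=> /subnK <-; elim: (n - m)%N => [|k IH]; first exact: prefix_refl.
exact: prefix_trans IH (xi_prefix _).
Qed.

(** The stretch of the sequence between degrees [p] and [q], intended as the value of the limit path
    at [(p, q)]. *)
Let segment (p q : G) (b : L) : Prop := exists n a c,
  [/\ deg a = p, deg b = q - p, comp a b c & is_prefix c (xi n)].

Let segment_le p q b n : segment p q b -> exists n0 a c,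
  [/\ (n <= n0)%N, deg a = p, deg b = q - p, comp a b c & is_prefix c (xi n0)].
Proof.
move=> [m [a [c [da db hc hm]]]]; exists (maxn m n), a, c; split=> //.
  exact: leq_maxr.
by apply: prefix_trans hm _; apply: xi_le; apply: leq_maxl.
Qed.

Let segment_ex p q : p \in P -> q - p \in P -> exists b, segment p q b.
Proof.
move=> Pp Pqp.
have Pq : q \in P by rewrite -(subrK p q) rpredD.
have [n hn] := xi_cofinal Pq.
have [c [d [dc _ hc]]] := factor Pq hn.
have [|a [b [da db hab]]] := @factor c p Pp; first by rewrite dc.
by exists b, n, a, c; split=> //; [rewrite db dc | exists d].
Qed.

Let segment_uniq p q b b' : segment p q b -> segment p q b' -> b = b'.
Proof.
move=> sb [n [a' [c' [da' db' hc' hn']]]].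
have [m [a [c [le_nm da db hc hm]]]] := segment_le n sb.
have hm' := prefix_trans hn' (xi_le le_nm).
have ecc : c = c'.
  apply: prefix_inj hm hm' _.
  by rewrite (deg_comp gL hc) (deg_comp gL hc') da da' db db'.
subst c'; have [] := comp_inj hc hc' => //; by rewrite da.
Qed.

(** Cofinality provides a segment at every [(p, q)]; it is unique because two segments can be
    compared inside one late [xi n]. Functoriality follows by exhibiting each expected value as a
    segment. *)
Lemma path_of_prefixes : exists x : Omega_graph P -> L,
  infinite_paths x /\ forall n, x (opair P 0 (deg (xi n))) = xi n.
Proof.
have /choice[x xP] : forall w : Omega_graph P, exists b,
    segment (val w).1 (val w).2 b.
  by move=> w; have /and3P[? _ ?] := valP w; apply: segment_ex.
exists x; split; last first.
  move=> n; set p := deg (xi n).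
  have Pp : p \in P by exact: deg_in gL _.
  apply: segment_uniq (xP _) _; rewrite val_opair ?rpred0 ?subr0 //=.
  exists n, (rng (xi n)), (xi n); split; rewrite ?deg_rng ?subr0 //.
    exact: comp_rng.
  exact: prefix_refl.
split=> [w|w|u v w|w].
- apply: segment_uniq (xP _) _ => /=.
  have [n [a [c [da db hc hn]]]] := xP w.
  exists n, a, a; split; rewrite ?deg_rng ?subrr //.
    by rewrite -(comp_src_rng hc); exact: comp_src.
  by apply: prefix_trans hn; exists (x w).
- apply: segment_uniq (xP _) _ => /=.
  have [n [a [c [da db hc hn]]]] := xP w.
  exists n, c, c; split; rewrite ?deg_src ?subrr //.
    by rewrite (deg_comp gL hc) da db addrC subrK.
  by rewrite -(src_comp cL hc); exact: comp_src.
- move=> [/= euv ew].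
  have [n [a [c [da db hc hn]]]] := xP u.
  have [m [a' [c' [le_nm da' db' hc' hm]]]] := segment_le n (xP v).
  have {}hn := prefix_trans hn (xi_le le_nm).
  have ea : a' = c.
    apply: (@prefix_inj _ _ (xi m) _ hn).
      by apply: prefix_trans hm; exists (x v).
    by rewrite (deg_comp gL hc) da db da' -euv addrC subrK.
  subst a'.
  have [bb hbb] : exists bb, comp (x u) (x v) bb.
    by apply: comp_ex; rewrite -(src_comp cL hc) (comp_src_rng hc').
  rewrite -(@segment_uniq (val w).1 (val w).2 bb (x w)) //.
  exists m, a, c'; rewrite /= ew /=; split=> //.
    by rewrite (deg_comp gL hbb) db db' -euv addrC addrA subrK.
  exact: comp_assoc hc hbb hc'.
- by have [n [a [c [_ -> _ _]]]] := xP w.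
Qed.

End PathOfPrefixes.

(** * Infinite paths with prescribed beginnings, and a criterion for aperiodicity *)

Section Enumeration.
Variable e : nat -> G.
Hypothesis e_in : forall n, e n \in P.
Hypothesis e_surj : forall p, p \in P -> exists n, e n = p.

(** Step [n] raises the degree by at least [e n], and [e] reaches all of [P]. *)
Lemma cofinal_of_steps (d : nat -> G) : d 0%N \in P ->
  (forall n, d n.+1 - (d n + e n) \in P) ->
  forall p, p \in P -> exists n, d n - p \in P.
Proof.
move=> d0 hd p /e_surj[n <-]; exists n.+1.
have dP : d n \in P.
  elim: n => [//|n IH]; rewrite -(subrK (d n + e n) (d n.+1)).
  exact: rpredD (hd n) (rpredD IH (e_in n)).
have -> : d n.+1 - e n = d n.+1 - (d n + e n) + d n.
  by rewrite opprD addrA addrAC subrK.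
exact: rpredD (hd n) dP.
Qed.

Lemma path_through c : exists x : Omega_graph P -> L,
  infinite_paths x /\ x (opair P 0 (deg c)) = c.
Proof.
have /choice[f fP] : forall nc : nat * L, exists c',
    is_prefix nc.2 c' /\ deg c' = deg nc.2 + e nc.1.
  move=> [n c0]; have [b [c' [db h]]] := extend c0 (e_in n).
  by exists c'; split; [exists b | rewrite (deg_comp gL h) db].
pose xi n := iteri n (fun k c' => f (k, c')) c.
have [||x [hx xE]] := @path_of_prefixes xi.
- by move=> n; have [] := fP (n, xi n).
- apply: cofinal_of_steps => [|n]; first exact: deg_in gL _.
  by have [_ /= ->] := fP (n, xi n); rewrite subrr rpred0.
- by exists x; split=> //; apply: xE 0%N.
Qed.

(** Shifting by [deg a] deletes [a] from the beginning [a k] of [x], so the shifted path begins with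
    [k]. *)
Lemma path_segment (x : Omega_graph P -> L) a k c u : infinite_paths x ->
  x (opair P 0 (deg c)) = c -> comp a k c -> is_prefix u k ->
  shift (deg a) x (opair P 0 (deg u)) = u.
Proof.
move=> hx xc hc [w hw].
have dk := deg_comp gL hw; have dc := deg_comp gL hc.
have Pa := deg_in gL a; have Pu := deg_in gL u; have Pw := deg_in gL w.
have Pk := deg_in gL k.
rewrite /shift val_opair ?rpred0 ?subr0 //= addr0.
have h1 : comp (x (opair P 0 (deg a))) (x (opair P (deg a) (deg c))) c.
  rewrite -[X in comp _ _ X]xc.
  apply: path_comp; rewrite ?rpred0 ?subr0 //.
  by rewrite dc addrAC subrr add0r.
have [_ ek] := comp_inj hc h1 (esym (path_deg0 hx Pa)).
have h2 : comp (x (opair P (deg a) (deg a + deg u)))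
    (x (opair P (deg a + deg u) (deg c))) k.
  rewrite ek; apply: path_comp => //; first by rewrite addrAC subrr add0r.
  by rewrite dc dk addrA addrC addrK.
have [|->] := comp_inj h2 hw => //.
by rewrite path_deg // addrAC subrr add0r.
Qed.

(** The products of [a] with the initial segments of [x] in the degrees [d n], the partial sums of
    [e], increase to an infinite path; so [prepend] does not take its default value. *)
Lemma prependP a (x : Omega_graph P -> L) :
  infinite_paths_to (src a) x -> is_prepend a x (prepend a x).
Proof.
move=> [hx x0]; apply: xgetPex.
have /choice[f fP] : forall p, exists c, p \in P -> comp a (x (opair P 0 p)) c.
  move=> p; have [Pp|nPp] := boolP (p \in P); last by exists a.
  by have [|c h] := @comp_ex a (x (opair P 0 p)); [rewrite path_rng | exists c].
pose d n := \sum_(i < n) e i.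
have dP n : d n \in P by apply: rpred_sum.
have dS n : d n.+1 = d n + e n by rewrite /d big_ord_recr.
have dxi n : deg (f (d n)) = deg a + d n.
  by rewrite (deg_comp gL (fP _ (dP n))) path_deg0.
have [||y [hy yE]] := @path_of_prefixes (fun n => f (d n)).
- move=> n; apply: prefix_comp (fP _ (dP n)) (fP _ (dP n.+1)) _.
  by apply: path_prefix; rewrite // dS addrAC subrr add0r.
- apply: cofinal_of_steps => [|n]; first exact: deg_in gL _.
  by rewrite !dxi dS addrA subrr rpred0.
exists y; split=> // p Pp Ppa.
have [n hn] : exists n, d n - (p - deg a) \in P.
  apply: cofinal_of_steps Ppa; first exact: dP.
  by move=> n; rewrite dS subrr rpred0.
have hc := fP _ (dP n).
have [c hc'] : exists c, comp a (x (opair P 0 (p - deg a))) c.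
  by apply: comp_ex; rewrite path_rng.
have pc : is_prefix c (f (d n)).
  by apply: prefix_comp hc' hc _; apply: path_prefix.
have dc : deg c = p by rewrite (deg_comp gL hc') path_deg0 // addrC subrK.
suff -> : y (opair P 0 p) = c by [].
apply: prefix_inj pc _; last by rewrite path_deg0.
rewrite -[X in is_prefix _ X]yE; apply: path_prefix => //.
by move: hn; rewrite dxi opprB addrA [d n + _]addrC.
Qed.

Lemma path_eqP a b : path_eq P a b <-> finite_path_eq a b.
Proof.
split=> -[sab h]; split=> //.
  move=> z c c' hc hc' u u' uc uc' du.
  (* For [x] beginning with [z], the equal infinite paths [a x] and [b x] begin with [c] and
     [c']. *)
  have [x [hx xz]] := path_through z.
  have x0 : infinite_paths_to (src a) x.
    split=> //=; rewrite -(path_rng hx (deg_in gL z)) xz.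
    by rewrite (comp_src_rng hc).
  have ya := prependP x0; have hy := ya.1.
  have x0' := x0; rewrite sab in x0'.
  have yb := prependP x0'; rewrite -(h x x0) in yb.
  have yc a0 c0 : comp a0 z c0 -> is_prepend a0 x (prepend a x) ->
      prepend a x (opair P 0 (deg c0)) = c0.
    move=> h0 [_ /(_ (deg c0) (deg_in gL c0))].
    have -> : deg c0 - deg a0 = deg z.
      by rewrite (deg_comp gL h0) addrAC subrr add0r.
    by move/(_ (deg_in gL z)); rewrite xz => h1; apply: comp_unique h1 h0.
  have pre c0 u0 : prepend a x (opair P 0 (deg c0)) = c0 -> is_prefix u0 c0 ->
      prepend a x (opair P 0 (deg u0)) = u0.
    move=> h0 [w hw]; have h1 : is_prefix (prepend a x (opair P 0 (deg u0))) c0.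
      rewrite -[X in is_prefix _ X]h0; apply: path_prefix => //.
        exact: deg_in gL _.
      by rewrite (deg_comp gL hw) addrAC subrr add0r (deg_in gL).
    apply: prefix_inj h1 _ _; first by exists w.
    by rewrite path_deg0 // (deg_in gL).
  rewrite -(pre c u) ?(yc a c hc ya) // du.
  by rewrite (pre c' u') ?(yc b c' hc' yb).
(* Conversely, the initial segments of degree [p] are compared inside [a z] and [b z], where [z] is
   the initial segment of degree [p] of [x]. *)
move=> x x0; have x0' := x0; rewrite sab in x0'.
have [hy yE] := prependP x0; have [hy' yE'] := prependP x0'.
apply: path_ext => // p Pp.
have Pa := deg_in gL a; have Pb := deg_in gL b.
have hc := yE (deg a + p); have hc' := yE' (deg b + p).
rewrite [deg a + p]addrC addrK [p + _]addrC in hc.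
rewrite [deg b + p]addrC addrK [p + _]addrC in hc'.
apply: (h _ _ _ (hc _ Pp) (hc' _ Pp)); rewrite ?rpredD ?path_deg0 //.
- by apply: path_prefix; rewrite ?addrK.
- by apply: path_prefix; rewrite ?addrK.
Qed.

(* If the shifts by [p] and [q] agreed on all infinite paths extending [c], then
   cancelling initial segments of degrees [p] and [q] from an extension of [c]
   would leave two equivalent paths of different degrees. *)
Lemma break_period c p q :
  (forall a b, finite_path_eq a b -> deg a = deg b) ->
  p \in P -> q \in P -> p != q ->
  exists c', is_prefix c c' /\
    forall x : Omega_graph P -> L, infinite_paths x ->
      x (opair P 0 (deg c')) = c' -> shift p x <> shift q x.
Proof.
move=> per0 Pp Pq /eqP npq.
(* The extra degree [p + q] gives [c1] initial segments of degrees [p] and [q], with complements [b]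
   and [b']. *)
have [w [c1 [dw hc1]]] := extend c (rpredD Pp Pq).
have dc1 : deg c1 = deg c + (p + q) by rewrite (deg_comp gL hc1) dw.
have Pc := deg_in gL c.
have [|a [b [da db hab]]] := @factor c1 p Pp.
  by rewrite dc1 [p + q]addrC addrA addrK rpredD.
have [|a' [b' [da' db' hab']]] := @factor c1 q Pq.
  by rewrite dc1 addrA addrK rpredD.
have nbb' : ~ finite_path_eq b b'.
  by move/per0; rewrite db db' => /addrI/oppr_inj.
apply: contra_notP nbb' => H; split.
  by rewrite -(src_comp cL hab) -(src_comp cL hab').
(* If [z] separates [b] from [b'], then [c1 z] is the required extension: the two shifts of [x]
   begin with [u] and [u']. *)
move=> z k k' hk hk' u u' uk uk' du; apply: contrapT => nu; apply: H.
have [c' hc'] : exists c', comp c1 z c'.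
  by apply: comp_ex; rewrite (src_comp cL hab) (comp_src_rng hk).
exists c'; split.
  by apply: (@prefix_trans c1); [exists w | exists z].
move=> x hx xc' e_shift; apply: nu.
rewrite -(path_segment hx xc' (comp_assoc cL hab hk hc') uk).
rewrite -[RHS](path_segment hx xc' (comp_assoc cL hab' hk' hc') uk').
by rewrite da da' e_shift du.
Qed.

(** Step [n] of the chain adds at least the degree [e n] and, when [n] encodes [(i, j)] with
    [e i != e j], also makes the shifts by [e i] and [e j] differ. *)
Lemma aperiodic_of_trivial_Per :
  (forall a b, finite_path_eq a b -> deg a = deg b) -> aperiodic P L.
Proof.
move=> per0 [v vv vper].
have /choice[f fP] : forall nc : nat * L, exists c',
    [/\ is_prefix nc.2 c', deg c' - (deg nc.2 + e nc.1) \in P &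
      forall i j, nc.1 = pickle (i, j) -> e i != e j ->
      forall x : Omega_graph P -> L, infinite_paths x ->
      x (opair P 0 (deg c')) = c' -> shift (e i) x <> shift (e j) x].
  move=> [n c]; have [b [c1 [db h1]]] := extend c (e_in n).
  have dc1 : deg c1 = deg c + e n by rewrite (deg_comp gL h1) db.
  have pc1 : is_prefix c c1 by exists b.
  have [[[i j] ij]|nij]  :=
      pselect (exists ij, n = pickle ij /\ e ij.1 != e ij.2).
    have [/= en eij] := ij.
    have [c' [[w pc'] xc']] := break_period c1 per0 (e_in i) (e_in j) eij.
    exists c'; split=> /=.
    - by apply: prefix_trans pc1 _; exists w.
    - by rewrite (deg_comp gL pc') dc1 addrAC subrr add0r (deg_in gL).
    - move=> i' j'; rewrite en => eij'; have := pcan_inj pickleK eij'.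
      by move=> [<- <-] _; apply: xc'.
  exists c1; split=> //=; first by rewrite dc1 subrr rpred0.
  by move=> i j en eij; case: nij; exists (i, j).
pose xi n := iteri n (fun k c' => f (k, c')) v.
have [||x [hx xE]] := @path_of_prefixes xi.
- by move=> n; have [] := fP (n, xi n).
- apply: cofinal_of_steps => [|n]; first exact: deg_in gL _.
  by have [] := fP (n, xi n).
have xv : infinite_paths_to v x.
  by split=> //=; have := xE 0%N; rewrite /= (deg_vertex gL vv).
have [p [q [/e_surj[i <-] /e_surj[j <-] nij eij]]] := vper x xv.
(* The pair [(i, j)] is treated in passing from [xi n] to [xi n.+1], so it is the beginning
   [xi n.+1] of [x] that separates the shifts. *)
set n := pickle (i, j); have [_ _ /(_ i j erefl nij x hx)] := fP (n, xi n).
by apply=> //; apply: xE n.+1.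
Qed.

End Enumeration.

End Pgraph.

(** * The pushout *)

Section Pushout.
Variables (G : zmodType) (P : addrClosed G) (L : pregraph G).
Hypothesis gL : is_Pgraph P L.
Variable e : nat -> G.
Hypothesis e_in : forall n, e n \in P.
Hypothesis e_surj : forall p, p \in P -> exists n, e n = p.
Hypothesis L_nonempty : [set: L] !=set0.
Hypothesis L_Per : Per_vertices P L = vertices L.
Implicit Types (a b c u v : L) (p q : G).

Let cL : is_category L := Pgraph_category gL.
Let path_eq_finite a b : path_eq P a b <-> finite_path_eq a b :=
  path_eqP gL e_in e_surj a b.

Notation Gamma := (pushout P L).
Notation pr := (quotient_map P L).
Notation prP := (image_monoid pr P).

Definition pushout_class a : Gamma := \pi_(pushout_mor P L) a.
Local Notation cls := pushout_class.

Lemma pushout_classP a b : cls a = cls b <-> path_eq P a b.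
Proof.
split=> [/eqP|h]; last by apply/eqP; rewrite eqmodE; apply/asboolP.
by rewrite eqmodE => /asboolP.
Qed.

Lemma pushout_class_surj (g : Gamma) : exists a, g = cls a.
Proof. by exists (repr g); rewrite /pushout_class reprK. Qed.

Lemma path_eq_repr a : path_eq P (repr (cls a)) a.
Proof. by apply/pushout_classP; rewrite /pushout_class reprK. Qed.

Lemma path_eq_sym a b : path_eq P a b -> path_eq P b a.
Proof. by move/pushout_classP=> h; apply/pushout_classP. Qed.

Lemma path_eq_trans b a c : path_eq P a b -> path_eq P b c -> path_eq P a c.
Proof.
by move=> /pushout_classP h /pushout_classP h'; apply/pushout_classP; rewrite h.
Qed.

Lemma path_eq_rng a b : path_eq P a b -> rng a = rng b.
Proof. by move/path_eq_finite/(finite_path_eq_rng gL). Qed.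

Lemma path_eq_deg a b : path_eq P a b -> deg a = deg b -> a = b.
Proof. by move/path_eq_finite/(finite_path_eq_deg gL). Qed.

(** One factor is replaced at a time, through [a' b]. *)
Lemma path_eq_comp a a' b b' ab ab' : path_eq P a a' -> path_eq P b b' ->
  comp a b ab -> comp a' b' ab' -> path_eq P ab ab'.
Proof.
move=> ha hb hab hab'.
have [a'b ha'b] : exists c, comp a' b c.
  apply: (comp_ex gL); rewrite (path_eq_rng hb) -ha.1.
  by rewrite (comp_src_rng gL hab) (path_eq_rng hb).
apply: (@path_eq_trans a'b); apply/path_eq_finite.
  by apply: (finite_path_eq_compl gL _ hab ha'b); apply/path_eq_finite.
by apply: (finite_path_eq_compr gL _ ha'b hab'); apply/path_eq_finite.
Qed.

(** This is [L_Per] at the vertex [rng a]. *)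
Lemma Per_lift a p : p \in P -> Per P L (deg a - p) ->
  exists2 b, deg b = p & path_eq P a b.
Proof.
move=> Pp Pap; have := vertices_rng gL a; rewrite -L_Per => -[_ h].
by have [b [_ db] ab] := h a p erefl Pp Pap; exists b.
Qed.

(* Adding [d(a) - d(b)] and [d(a') - d(b')]: a path of degree [d(a) + d(a')] is
   equivalent to one of degree [d(b) + d(a')], and that one to a path of degree
   [d(b) + d(b')]. *)
Lemma Per_zmod_closed : zmod_closed (fun g => `[< Per P L g >] : bool).
Proof.
have PerN g : Per P L g -> Per P L (- g).
  by move=> [a [b [/path_eq_sym ab ->]]]; exists b, a; rewrite opprB.
have PerD g g' : Per P L g -> Per P L g' -> Per P L (g + g').
  move=> gPer gPer'; move: (gPer) (gPer').
  move=> [a [b [_ eg]]] [a' [b' [_ eg']]].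
  have dP := deg_in gL.
  have [w [c [dw hc]]] := extend gL a (dP a').
  have dc : deg c = deg a + deg a' by rewrite (deg_comp gL hc) dw.
  have [||c1 dc1 cc1] := @Per_lift c (deg b + deg a').
  - by rewrite rpredD.
  - by rewrite dc opprD addrACA subrr addr0 -eg.
  have [||c2 dc2 cc2] := @Per_lift c1 (deg b + deg b').
  - by rewrite rpredD.
  - by rewrite dc1 opprD addrACA subrr add0r -eg'.
  exists c, c2; split; first exact: path_eq_trans cc1 cc2.
  by rewrite dc dc2 eg eg' opprD addrACA.
split=> [|x y /asboolP hx /asboolP hy]; apply/asboolP.
  by have [a _] := L_nonempty; exists a, a; rewrite subrr.
exact: PerD hx (PerN _ hy).
Qed.

Lemma quotient_mapP p q : pr p = pr q <-> Per P L (p - q).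
Proof.
have -> : Per P L (p - q) <-> p - q \in subgroup_generated (Per P L).
  split=> [h|/asboolP h]; first by apply/asboolP => N; apply.
  (* [Per] is itself one of the subgroups that [subgroup_generated] intersects. *)
  pose N : zmodClosed G := HB.pack (fun g => `[< Per P L g >] : bool)
    (GRing.isZmodClosed.Build G (fun g => `[< Per P L g >] : bool)
      Per_zmod_closed).
  by apply/asboolP; apply: (h N) => g hg; apply/asboolP.
rewrite Quotient.idealrBE /quotient_map.
by split=> /eqP.
Qed.

Lemma rng_class a : rng (cls a) = cls (rng a).
Proof. by rewrite /= (path_eq_rng (path_eq_repr a)). Qed.

Lemma src_class a : src (cls a) = cls (src a).
Proof. by rewrite /= (path_eq_repr a).1. Qed.

Lemma deg_class a : deg (cls a) = pr (deg a).
Proof.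
apply/quotient_mapP; exists (repr (cls a)), a.
by split=> //; apply: path_eq_repr.
Qed.

Lemma comp_class a b c : comp a b c -> comp (cls a) (cls b) (cls c).
Proof. by move=> h; exists a, b, c. Qed.

Lemma class_inj0 u v : deg u = deg v -> cls u = cls v -> u = v.
Proof. by move=> duv /pushout_classP /path_eq_deg; apply. Qed.

(** Some representatives compose by definition; equivalence preserves ranges and sources, so the
    given ones compose too. *)
Lemma comp_classE a b (g : Gamma) :
  comp (cls a) (cls b) g -> exists2 c, comp a b c & g = cls c.
Proof.
move=> [a' [b' [c' [hc [/pushout_classP ea /pushout_classP eb ->]]]]].
have [c h] : exists c, comp a b c.
  apply: (comp_ex gL); rewrite ea.1 (path_eq_rng eb).
  exact: comp_src_rng gL _ _ _ hc.
exists c => //; apply/pushout_classP.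
by apply: path_eq_comp hc h; apply: path_eq_sym.
Qed.

Lemma pushout_category : is_category Gamma.
Proof.
split.
- by move=> g; have [a ->] := pushout_class_surj g; rewrite !rng_class rng_rng.
- move=> g; have [a ->] := pushout_class_surj g.
  by rewrite rng_class src_class src_rng.
- move=> g; have [a ->] := pushout_class_surj g.
  by rewrite src_class rng_class rng_src.
- by move=> g; have [a ->] := pushout_class_surj g; rewrite !src_class src_src.
- move=> g h; have [a ->] := pushout_class_surj g.
  have [b ->] := pushout_class_surj h.
  rewrite src_class rng_class; split=> [[k]|/class_inj0 sab].
    by move/comp_classE => [c hc _]; rewrite (comp_src_rng gL hc).
  have [|c hc] := comp_ex gL (sab _).
    by rewrite (deg_src gL) (deg_rng gL).
  by exists (cls c); apply: comp_class.
- move=> g h k k'; have [a ->] := pushout_class_surj g.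
  have [b ->] := pushout_class_surj h.
  move=> /comp_classE[c hc ->] /comp_classE[c' hc' ->].
  by rewrite (comp_unique cL hc hc').
- move=> g h k; have [a ->] := pushout_class_surj g.
  have [b ->] := pushout_class_surj h.
  by move=> /comp_classE[c hc ->]; rewrite !rng_class (rng_comp cL hc).
- move=> g h k; have [a ->] := pushout_class_surj g.
  have [b ->] := pushout_class_surj h.
  by move=> /comp_classE[c hc ->]; rewrite !src_class (src_comp cL hc).
- move=> g; have [a ->] := pushout_class_surj g; rewrite rng_class.
  exact/comp_class/comp_rng.
- move=> g; have [a ->] := pushout_class_surj g; rewrite src_class.
  exact/comp_class/comp_src.
- move=> g h k gh hk x; have [a ->] := pushout_class_surj g.
  have [b ->] := pushout_class_surj h; have [c ->] := pushout_class_surj k.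
  move=> /comp_classE[ab hab ->] /comp_classE[bc hbc ->] /comp_classE[y hy ->].
  by apply: comp_class; apply: (comp_assoc cL) hab hbc hy.
Qed.

(** A representative of degree exactly [p], unique by [class_inj0], lets the axioms on degrees pass
    from [L] to the quotient. *)
Lemma class_lift a p : p \in P -> deg (cls a) = pr p ->
  exists2 b, deg b = p & cls a = cls b.
Proof.
rewrite deg_class => Pp /quotient_mapP /(Per_lift Pp)[b db ab].
by exists b => //; apply/pushout_classP.
Qed.

Lemma image_monoidE (g : Quotient.quot (subgroup_generated (Per P L))) :
  g \in prP <-> exists2 p, p \in P & g = pr p.
Proof.
by split=> [/asboolP[p Pp <-]|[p Pp ->]]; [|apply/asboolP]; exists p.
Qed.

Lemma pushout_vertex (g : Gamma) : vertices Gamma g ->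
  exists2 v, vertices L v & g = cls v.
Proof.
have [a ->] := pushout_class_surj g; move=> h.
exists (rng a); first exact: vertices_rng gL a.
by rewrite -rng_class.
Qed.

Lemma pushout_Pgraph : is_Pgraph prP Gamma.
Proof.
split.
- exact: pushout_category.
- have -> : [set: Gamma] = cls @` [set: L].
    apply/seteqP; split=> // g _; have [a ->] := pushout_class_surj g.
    by exists a.
  exact: sub_countable (card_image_le _ _) (Pgraph_countable gL).
- move=> g; have [a ->] := pushout_class_surj g; rewrite deg_class.
  by apply/image_monoidE; exists (deg a) => //; apply: deg_in gL _.
- move=> g /pushout_vertex[v vv ->].
  by rewrite deg_class (deg_vertex gL vv) raddf0.
- move=> g h k; have [a ->] := pushout_class_surj g.
  have [b ->] := pushout_class_surj h.
  move=> /comp_classE[c hc ->]; rewrite !deg_class (deg_comp gL hc).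
  exact: raddfD.
(* Factorization: a representative of degree exactly [p + q] is factored in [L], and the factors are
   projected. *)
- move=> p' q' g /image_monoidE[p Pp ->] /image_monoidE[q Pq ->] dg.
  have [a0 ea0] := pushout_class_surj g; subst g.
  have [|a da ea] := @class_lift a0 (p + q) (rpredD Pp Pq).
    by rewrite dg raddfD.
  rewrite {}ea in dg *.
  have [[b c] [[/= db dc hbc] U]] := factorization gL Pp Pq da.
  exists (cls b, cls c); split.
    by rewrite -db -dc; split; [apply: deg_class..|apply: comp_class].
  (* Uniqueness: another factorization lifts to factors of degrees [p] and [q], whose product has
     the class and the degree of [a]. *)
  move=> [g h] [dg' dh' hgh].
  have {}hgh : comp (g : Gamma) (h : Gamma) (cls a) := hgh.
  have [b0 eb0] := pushout_class_surj g; have [c0 ec0] := pushout_class_surj h.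
  subst g h.
  have [b' db' eb'] := class_lift Pp dg'.
  have [c' dc' ec'] := class_lift Pq dh'.
  rewrite {}eb' {}ec' in hgh *.
  have [a' ha' ea'] := comp_classE hgh.
  have eaa : a = a'.
    by apply: class_inj0 ea'; rewrite da (deg_comp gL ha') db' dc'.
  subst a'; have [-> ->] // : (b, c) = (b', c') by apply: U.
(* Every path of degree [pr p] with range [cls v] is the class of one of the finitely many paths of
   degree [p] with range [v]. *)
- move=> g p' /pushout_vertex[v vv ->] /image_monoidE[p Pp ->].
  apply: sub_finite_set (finite_image cls (row_finite gL vv Pp)).
  move=> h [rh dh]; have [a0 ea] := pushout_class_surj h; subst h.
  have [a da ea] := class_lift Pp dh; rewrite {}ea rng_class in rh *.
  exists a => //; split=> //; apply: class_inj0 rh.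
  by rewrite (deg_rng gL) (deg_vertex gL vv).
- move=> g p' /pushout_vertex[v vv ->] /image_monoidE[p Pp ->].
  have [a [ra da]] := source_free gL vv Pp.
  by exists (cls a); split; rewrite ?rng_class ?deg_class ?ra ?da.
Qed.

(* Equivalent paths of equal degree coincide, so [L] and its quotient have the
   same initial segments, and [finite_path_eq] descends to the quotient. *)
Lemma pushout_finite_path_eq a b :
  finite_path_eq (cls a) (cls b) -> path_eq P a b.
Proof.
rewrite /finite_path_eq !src_class => -[/class_inj0 sab h].
apply/path_eq_finite.
split=> [|z c c' hc hc' u u' [w uc] [w' uc'] du].
  by apply: sab; rewrite !(deg_src gL).
apply: class_inj0 => //.
apply: (h _ _ _ (comp_class hc) (comp_class hc')); rewrite ?deg_class ?du //.
- by exists (cls w); apply: comp_class.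
- by exists (cls w'); apply: comp_class.
Qed.

(** Equivalent classes come from equivalent paths of [L], whose degrees differ by an element of
    [Per]. *)
Lemma pushout_aperiodic : aperiodic prP Gamma.
Proof.
apply: (@aperiodic_of_trivial_Per _ _ _ pushout_Pgraph (fun n => pr (e n))).
- by move=> n; apply/image_monoidE; exists (e n).
- move=> p' /image_monoidE[p /e_surj[n <-] ->]; by exists n.
- move=> g h; have [a ->] := pushout_class_surj g.
  have [b ->] := pushout_class_surj h.
  move/pushout_finite_path_eq => ab; rewrite !deg_class.
  by apply/quotient_mapP; exists a, b.
Qed.

End Pushout.

(** The coefficient vectors over the generators are countably many; integers that encode none of
    them are sent to 0. *)
Lemma groth_monoid_enum (P : nmodType) : finitely_generated P ->
  exists e : nat -> groth P, (forall n, e n \in groth_monoid P) /\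
    forall p, p \in groth_monoid P -> exists n, e n = p.
Proof.
move=> [gen genP].
pose f (c : {ffun 'I_(size gen) -> nat}) := \sum_(i < size gen) gen`_i *+ c i.
exists (fun n => groth_in (if unpickle n is Some c then f c else 0)).
split=> [n|p /asboolP[x <-]]; first by apply/asboolP; eexists.
have [c xc] := genP x; exists (pickle [ffun i => c i]).
rewrite pickleK xc; congr groth_in; apply: eq_bigr => i _.
by rewrite ffunE.
Qed.

Theorem theorem5p3 (P : nmodType)
    (P_cancel : cancellative P) (P_fg : finitely_generated P)
    (L : pregraph (groth P))
    (L_graph : is_Pgraph (groth_monoid P) L)
    (L_nonempty : [set: L] !=set0)
    (L_W : propertyW L)
    (L_Per : Per_vertices (groth_monoid P) L = vertices L) :
  let q := quotient_map (groth_monoid P) L in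
  let qP := image_monoid q (groth_monoid P) in
  is_Pgraph qP (pushout (groth_monoid P) L) /\
  aperiodic qP (pushout (groth_monoid P) L).
Proof.
have [e [e_in e_surj]] := groth_monoid_enum P_fg.
split.
- exact: pushout_Pgraph L_graph _ e_in e_surj L_nonempty L_Per.
- exact: pushout_aperiodic L_graph _ e_in e_surj L_nonempty L_Per.
Qed.
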